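(* Let $m\ge 2$ be an integer and let $\mathcal{F}$ be a family of connected bipartite graphs, each having at least $m$ edges. Let $k_v^{\le m}$ be the number of graphs in $\mathcal{F}$ with at most $m$ vertices and $k_e^m$ the number of graphs in $\mathcal{F}$ with exactly $m$ edges. Then $$\chi_{2,\mathcal{F}}(\Delta) < (k_v^{\le m}+71)(m+1)\Delta^{\frac{m}{m-1}}$$ and $$\chi_{2,\mathcal{F}}(\Delta) < \left(k_e^m + 1 + o(1)\right)(m+1)\Delta^{\frac{m}{m-1}},$$ where $o(1)$ tends to $0$ as $\Delta\to\infty$.
   Context: A $(2,\mathcal{F})$-subgraph coloring of a graph $G$ is a proper vertex-coloring of $G$ such that, for any two color classes, the subgraph of $G$ induced by their union contains no subgraph isomorphic to any $H\in\mathcal{F}$. $\chi_{2,\mathcal{F}}(G)$ is the minimum number of colors of such a coloring, and $\chi_{2,\mathcal{F}}(\Delta)$ is the maximum of $\chi_{2,\mathcal{F}}(G)$ over all graphs $G$ with maximum degree at most $\Delta$. Graphs in $\mathcal{F}$ are counted up to isomorphism. *)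

(* Defs.v *)
From Stdlib Require Import Reals.
From mathcomp Require Import all_boot.

Set Implicit Arguments.
Unset Strict Implicit.
Unset Printing Implicit Defensive.

Record ograph := FGraph { fg_n : nat; fg_adj : rel 'I_fg_n }.
Arguments fg_adj : clear implicits.

Definition simple_fg (H : ograph) : Prop :=
  symmetric (fg_adj H) /\ irreflexive (fg_adj H).

Definition fg_edges (H : ograph) : nat :=
  #|[set p : prod 'I_(fg_n H) 'I_(fg_n H) | fg_adj H p.1 p.2 && (p.1 < p.2)%N]|.

Definition fg_connected (H : ograph) : Prop :=
  forall x y : 'I_(fg_n H), connect (fg_adj H) x y.

Definition fg_bipartite (H : ograph) : Prop :=
  exists f : 'I_(fg_n H) -> bool, forall x y, fg_adj H x y -> f x != f y.

Definition fg_iso (H1 H2 : ograph) : Prop :=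
  exists f : 'I_(fg_n H1) -> 'I_(fg_n H2),
    bijective f /\ forall x y, fg_adj H1 x y = fg_adj H2 (f x) (f y).

Definition count_iso_classes (F : ograph -> Prop) (P : ograph -> Prop) (k : nat)
  : Prop :=
  exists L : 'I_k -> ograph,
    (forall i, F (L i) /\ P (L i)) /\
    (forall i j, fg_iso (L i) (L j) -> i = j) /\
    (forall H, F H -> P H -> exists i, fg_iso H (L i)).

Definition contains_copy (T : finType) (e : rel T) (S : pred T) (H : ograph)
  : Prop :=
  exists phi : 'I_(fg_n H) -> T,
    injective phi /\ (forall a, S (phi a)) /\
    (forall a b, fg_adj H a b -> e (phi a) (phi b)).

Definition is_2F_coloring (F : ograph -> Prop) (T : finType) (e : rel T)
  (c : nat) (col : T -> 'I_c) : Prop :=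
  (forall x y, e x y -> col x != col y) /\
  (forall i j : 'I_c, i != j -> forall H, F H ->
     ~ contains_copy e (fun x => (col x == i) || (col x == j)) H).

Definition maxdeg_le (T : finType) (e : rel T) (D : nat) : Prop :=
  forall x, (#|[set y | e x y]| <= D)%N.

Definition chi2F_lt (F : ograph -> Prop) (T : finType) (e : rel T) (B : R)
  : Prop :=
  exists (c : nat) (col : T -> 'I_c), is_2F_coloring F e col /\ Rlt (INR c) B.

(* chi_{2,F}(D) < B: every finite simple graph of maximum degree at most D
   has chi_{2,F} < B (the maximum of these natural numbers is then < B). *)
Definition chi2F_Delta_lt (F : ograph -> Prop) (D : nat) (B : R) : Prop :=
  forall (T : finType) (e : rel T),
    symmetric e -> irreflexive e -> maxdeg_le e D -> chi2F_lt F e B.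

(* Main.v *)
(* Write N = D^(m/(m-1)) and t = D^(1/(m-1)), so that N = t^m and D = t^(m-1).
   Colorings are built one vertex at a time by Rosenfeld's counting argument:
   with enough colors, adding a vertex multiplies the number of admissible
   partial colorings by at least beta = b N. A forbidden configuration through
   the new vertex in which the colors of s vertices are determined by the
   others costs beta^(-(s-1)).

   Besides bicolored copies, one also forbids monochromatic heavy sets, a set W
   of j >= 2 vertices being heavy when it has at least N / t^j common
   neighbors. Double counting gives at most N^(j-1) heavy j-sets through a
   vertex, so each size j <= m costs at most N. Without heavy sets every edge
   saves a factor t: a connected graph on n vertices has at most
   N^(n-1) / t^edges embeddings with a prescribed root, hence cost at most N as
   soon as it has m edges, and at most N / t with more than m edges. In a
   bicolored copy all but two colors, the root's being one of the redundant
   ones, are determined by the others, unless the root is alone on its side;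
   then the copy is a star, whose leaves form a monochromatic heavy set.

   For the first bound, a graph with more than m vertices contains one of the
   m! trees grown by successive attachment of m vertices to the root; with
   b = m + 1 their total cost is N m! / (m+1)^(m-2) <= 2 N. For the second one,
   b = 1: a graph with more than m edges contains a connected graph with more
   than m edges on at most m + 2 vertices, and the finitely many such graphs
   cost O(N / t). *)

Require Import Defs.
From Stdlib Require Import Reals.
From mathcomp Require Import all_boot all_order all_algebra.
From mathcomp Require Import boolp Rstruct.
From mathcomp Require Import zify ring lra.

Set Implicit Arguments.
Unset Strict Implicit.
Unset Printing Implicit Defensive.

Import Order.TTheory GRing.Theory Num.Theory.

(** * Counting partial colorings one vertex at a time *)

Section PartialColorings.
Local Open Scope ring_scope.

Variables (T : finType) (c : nat) (c0 : 'I_c).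

(** Colors outside [V] are reset to the default [c0], so that a partial coloring on [V] is a total
    function fixed by [restr V] and can be counted in a finite set. *)
Definition restr (V : {set T}) (f : {ffun T -> 'I_c}) : {ffun T -> 'I_c} :=
  [ffun y => if y \in V then f y else c0].

(* An event (S, r) says that every vertex of S has the color of its
   representative outside S, so the colors on S are redundant. *)
Definition obeys (f : {ffun T -> 'I_c}) (ev : {set T} * {ffun T -> T}) :=
  [forall z in ev.1, f z == f (ev.2 z)].

Variable good : {set T} -> pred {ffun T -> 'I_c}.

Definition partials (V : {set T}) :=
  [set f : {ffun T -> 'I_c} | (restr V f == f) && good V f].

Lemma restr_restr (V W : {set T}) f :
  W \subset V -> restr W (restr V f) = restr W f.
Proof.
move=> /subsetP sWV; apply/ffunP => y; rewrite !ffunE.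
by case: ifP => // /sWV ->.
Qed.

Lemma card_has_le (A : finType) (I : Type) (P : A -> pred I) (s : seq I) :
  (#|[set a | has (P a) s]| <= \sum_(i <- s) #|[set a | P a i]|)%N.
Proof.
elim: s => [|i s IHs].
  by rewrite big_nil leqn0 cards_eq0; apply/eqP/setP => a; rewrite !inE.
rewrite big_cons; apply: leq_trans (leq_add (leqnn _) IHs).
apply: leq_trans (leq_card_setU _ _); apply: subset_leq_card.
by apply/subsetP => a; rewrite !inE.
Qed.

Hypothesis good_restr : forall (V W : {set T}) f,
  W \subset V -> good V f -> good W (restr W f).

Lemma card_extensions (V : {set T}) (x : T) : x \notin V ->
  (c * #|partials V| <=
   #|[set f | (restr (x |: V) f == f) && good V (restr V f)]|)%N.
Proof.
move=> xV; rewrite -[X in (X * _)%N](card_ord c) -cardsT mulnC -cardsX.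
pose h (p : {ffun T -> 'I_c} * 'I_c) := [ffun y => if y == x then p.2 else p.1 y].
have hr f i : f \in partials V -> restr V (h (f, i)) = f.
  rewrite inE => /andP[/eqP fV _]; rewrite -[RHS]fV.
  apply/ffunP => y; rewrite !ffunE; case: ifP => // yV.
  by case: eqP => // E; rewrite -E yV in xV.
rewrite -(card_in_imset (f := h)); last first.
  move=> [f i] [g j] /setXP[fV _] /setXP[gV _] E.
  congr (_, _); first by rewrite -(hr f i fV) E hr.
  by have := congr1 (fun k : {ffun T -> 'I_c} => k x) E; rewrite !ffunE eqxx.
apply: subset_leq_card; apply/subsetP => _ /imsetP[[f i] /setXP[fV _] ->].
rewrite inE hr //; move: (fV); rewrite inE => /andP[/eqP Ef ->]; rewrite andbT.
apply/eqP/ffunP => y; rewrite !ffunE !inE /=; case: eqP => //= _.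
by case: ifP => // yV; rewrite -Ef ffunE yV.
Qed.

(** Representatives lie outside [S], so the restriction to [V :\: S] determines an obeying
    coloring. *)
Lemma card_obeys (V S : {set T}) (r : {ffun T -> T}) :
  {in S, forall z, r z \notin S} -> 
  (#|[set f | (restr V f == f) && good (V :\: S) (restr (V :\: S) f)
      && obeys f (S, r)]| <= #|partials (V :\: S)|)%N.
Proof.
move=> rS; rewrite -(card_in_imset (f := restr (V :\: S))).
  apply: subset_leq_card; apply/subsetP => _ /imsetP[f + ->].
  rewrite !inE => /andP[/andP[_ ->] _]; rewrite andbT.
  by rewrite restr_restr.
move=> f g; rewrite !inE.
move=> /andP[/andP[/eqP fV _] /forall_inP fS] /andP[/andP[/eqP gV _] /forall_inP gS] E.
have off y : y \notin S -> f y = g y.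
  move=> yS; rewrite -fV -gV !ffunE; case: ifP => // yV.
  by have := congr1 (fun k : {ffun T -> 'I_c} => k y) E; rewrite !ffunE !inE yS yV.
apply/ffunP => y; have [yS|/off//] := boolP (y \in S).
by rewrite (eqP (fS y yS)) (eqP (gS y yS)) off // rS.
Qed.

Variables (R : realFieldType) (beta : R).
Variable evs : T -> seq ({set T} * {ffun T -> T}).
Hypothesis beta_gt0 : 0 < beta.
Hypothesis evs_wf : forall x ev, ev \in evs x ->
  x \in ev.1 /\ {in ev.1, forall z, ev.2 z \notin ev.1}.
Hypothesis evs_cover : forall (V : {set T}) x f, x \notin V ->
  good V (restr V f) -> ~~ good (x |: V) f -> 
  has (fun ev : {set T} * {ffun T -> T} => (ev.1 \subset x |: V) && obeys f ev) (evs x).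
Hypothesis evs_cost : forall x,
  beta + \sum_(ev <- evs x) beta ^- #|ev.1|.-1 <= c%:R.

(** Rosenfeld's induction on [#|V|]: among the at least [c * #|partials V|] extensions to [x], each
    bad one is charged to an event, and [evs_cost] bounds the total share of [#|partials V|] lost in
    this way. *)
Lemma partials_step (V : {set T}) (x : T) : x \notin V ->
  beta * #|partials V|%:R <= #|partials (x |: V)|%:R.
Proof.
have [n] := ubnP #|V|; elim: n V x => // n IHn V x; rewrite ltnS => Vn xV.
(* The induction hypothesis, iterated over [S]: uncoloring divides the count by at least [beta] per
   vertex. *)
have shrink (S : {set T}) : S \subset V ->
    beta ^+ #|S| * #|partials (V :\: S)|%:R <= #|partials V|%:R.
  have [k] := ubnP #|S|; elim: k S => // k IHk S; rewrite ltnS => Sk SV.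
  have [->|[z zS]] := set_0Vmem S; first by rewrite cards0 setD0 expr0 mul1r.
  have -> : V :\: S = (V :\: (S :\ z)) :\ z.
    by apply/setP => y; rewrite !inE; case: eqP => [->|//]; rewrite zS.
  apply: le_trans (IHk (S :\ z) _ _); last first.
  - by apply: subset_trans SV; rewrite subsetDl.
  - by rewrite (cardsD1 z S) zS in Sk.
  rewrite (cardsD1 z S) zS exprS [_ * _ ^+ _]mulrC -mulrA ler_pM2l ?exprn_gt0 //.
  have zV : z \in V :\: (S :\ z) by rewrite !inE eqxx /= (subsetP SV).
  rewrite -[in leRHS](setD1K zV); apply: IHn; last by rewrite !inE eqxx.
  apply: leq_trans Vn; apply: (@leq_trans #|V :\: (S :\ z)|).
    by rewrite [in X in (_ < X)%N](cardsD1 z) zV.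
  by rewrite subset_leq_card // subsetDl.
pose bad := [set f | (restr (x |: V) f == f) && good V (restr V f)
                     && ~~ good (x |: V) f].
pose P f (ev : {set T} * {ffun T -> T}) :=
  [&& ev.1 \subset x |: V, restr (x |: V) f == f, good V (restr V f) & obeys f ev].
have le_bad : (#|bad| <= \sum_(ev <- evs x) #|[set f | P f ev]|)%N.
  apply: leq_trans (card_has_le _ _); apply: subset_leq_card.
  apply/subsetP => f; rewrite !inE => /andP[/andP[fV gV] ngV].
  have := evs_cover xV gV ngV; apply: sub_has => ev /andP[? ?].
  by apply/and4P.
have le_ext : (c * #|partials V| <= #|partials (x |: V)| + #|bad|)%N.
  apply: leq_trans (card_extensions xV) _; apply: leq_trans (leq_card_setU _ _).
  apply: subset_leq_card; apply/subsetP => f; rewrite !inE => /andP[-> ->].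
  by case: good.
have le_ev ev : ev \in evs x ->
    #|[set f | P f ev]|%:R <= #|partials V|%:R * beta ^- #|ev.1|.-1.
  move=> evx; have [xS rS] := evs_wf evx; case: ev xS rS {evx} => S r /= xS rS.
  have [SV|nSV] := boolP (S \subset x |: V); last first.
    have -> : [set f | P f (S, r)] = set0.
      by apply/setP => f; rewrite !inE /P /= (negbTE nSV).
    by rewrite cards0 mulr_ge0 ?ler0n // invr_ge0 exprn_ge0 // ltW.
  rewrite ler_pdivlMr ?exprn_gt0 // mulrC.
  (* Since [x] is in [S] but not in [V], only [#|S|.-1] vertices of [V] get uncolored, whence the
     exponent in the cost. *)
  have E : (x |: V) :\: S = V :\: (S :\ x).
    by apply/setP => y; rewrite !inE; case: eqP => [->|//]; rewrite xS (negbTE xV).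
  have S1 : #|S|.-1 = #|S :\ x| by rewrite (cardsD1 x S) xS.
  rewrite S1; apply: le_trans (shrink (S :\ x) _); last first.
    apply/subsetP => y; rewrite !inE => /andP[yx yS].
    by have := subsetP SV _ yS; rewrite !inE (negbTE yx).
  rewrite ler_pM2l ?exprn_gt0 // ler_nat -E.
  apply: leq_trans (card_obeys (x |: V) rS); apply: subset_leq_card.
  apply/subsetP => f; rewrite !inE => /and4P[_ -> gV ->]; rewrite andbT /=.
  rewrite E; have sub : V :\: (S :\ x) \subset V by apply: subsetDl.
  by rewrite -(restr_restr _ sub); apply: good_restr sub gV.
have := ler_nat R (c * #|partials V|) (#|partials (x |: V)| + #|bad|).
rewrite le_ext natrM natrD => le1.
have le2 : #|bad|%:R <= #|partials V|%:R * \sum_(ev <- evs x) beta ^- #|ev.1|.-1.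
  apply: (@le_trans _ _ (\sum_(ev <- evs x) #|[set f | P f ev]|)%:R).
    by rewrite ler_nat.
  by rewrite natr_sum mulr_sumr big_seq [leRHS]big_seq ler_sum.
have := ler_wpM2l (ler0n R #|partials V|) (evs_cost x).
rewrite mulrDr => le3; rewrite mulrC; lra.
Qed.

Lemma exists_good : good set0 [ffun=> c0] -> exists f, good setT f.
Proof.
move=> good0.
suff pos V : (0 < #|partials V|)%N.
  by have /card_gt0P[f] := pos setT; rewrite inE => /andP[_]; exists f.
have [n] := ubnP #|V|; elim: n V => // n IHn V; rewrite ltnS => Vn.
have [->|[x xV]] := set_0Vmem V.
  apply/card_gt0P; exists [ffun=> c0]; rewrite inE good0 andbT.
  by apply/eqP/ffunP => y; rewrite !ffunE inE.
rewrite -(ltr0n R); have xVx : x \notin V :\ x by rewrite !inE eqxx.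
have := partials_step xVx; rewrite setD1K //; apply: lt_le_trans.
rewrite mulr_gt0 // ltr0n; apply: IHn.
by rewrite (cardsD1 x V) xV in Vn.
Qed.

End PartialColorings.

Lemma ffact_le_expn (n k : nat) : (n ^_ k <= n ^ k)%N.
Proof.
elim: k => // k IHk; rewrite ffactnSr expnSr.
by apply: leq_mul IHk _; apply: leq_subr.
Qed.

Lemma bin_le_expn (n k : nat) : ('C(n, k) <= n ^ k)%N.
Proof.
apply: leq_trans (ffact_le_expn n k); rewrite -bin_ffact.
by rewrite leq_pmulr // fact_gt0.
Qed.

(** * Heavy sets: reduction to size at most m, and their number *)

Section Heavy.
Local Open Scope ring_scope.

Variables (T : finType) (e : rel T) (R : realFieldType) (t : R) (m D : nat).
Hypothesis m_ge2 : (2 <= m)%N.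
Hypothesis t_ge1 : 1 <= t.

Let t_gt0 : 0 < t. Proof. exact: lt_le_trans ltr01 t_ge1. Qed.

(* Vertices adjacent to all of W; |common W| >= t^(m - |W|), written without
   negative exponents, defines heaviness. *)
Definition common (W : {set T}) := [set u | [forall w in W, e u w]].

Definition heavy (W : {set T}) :=
  (1 < #|W|)%N && (t ^+ m <= #|common W|%:R * t ^+ #|W|).

Definition heavy_at (x : T) (j : nat) :=
  [set W : {set T} | [&& x \in W, #|W| == j & heavy W]].

(** From size [m] on the threshold t^(m - |W|) is at most 1, so a single common neighbor
    suffices. *)
Lemma heavy_of_common (W : {set T}) u :
  u \in common W -> (1 < #|W|)%N -> (m <= #|W|)%N -> heavy W.
Proof.
move=> uW W1 Wm; rewrite /heavy W1 /=.
apply: (@le_trans _ _ (t ^+ #|W|)); first by rewrite ler_weXn2l.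
rewrite ler_peMl ?exprn_ge0 ?(ltW t_gt0) // ler1n.
by apply/card_gt0P; exists u.
Qed.

(** Only sizes up to [m] need events: a larger heavy set has a common neighbor, which already makes
    its [m]-subsets heavy. *)
Lemma heavy_subset (W : {set T}) x : heavy W -> x \in W ->
  exists W' : {set T}, [/\ W' \subset W, x \in W', heavy W' & (#|W'| <= m)%N].
Proof.
move=> hW xW; have [Wm|Wm] := leqP #|W| m; first by exists W; split.
have /andP[W1 cW] := hW.
have /card_gt0P[u uW] : (0 < #|common W|)%N.
  rewrite lt0n; apply/negP => /eqP C0; move: cW; rewrite C0 mul0r.
  by rewrite leNgt exprn_gt0.
pose A := [set z in take m.-1 (enum (W :\ x))].
have sA : A \subset W :\ x.
  by apply/subsetP => z; rewrite inE => /mem_take; rewrite mem_enum.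
have cA : #|A| = m.-1.
  rewrite cardsE; have /card_uniqP -> : uniq (take m.-1 (enum (W :\ x))).
    by rewrite take_uniq // enum_uniq.
  rewrite size_take -cardE; have := cardsD1 x W; rewrite xW; case: ltnP; lia.
have xA : x \notin A by apply/negP => /(subsetP sA); rewrite !inE eqxx.
have sW : x |: A \subset W.
  by rewrite subUset sub1set xW (subset_trans sA) // subsetDl.
have cxA : #|x |: A| = m by rewrite cardsU1 xA cA; lia.
exists (x |: A); split; rewrite ?cxA ?setU11 //.
apply: (@heavy_of_common _ u); rewrite ?cxA //.
move: uW; rewrite !inE => /forall_inP uW; apply/forall_inP => w wA.
by apply: uW; apply: (subsetP sW).
Qed.

Hypothesis e_sym : symmetric e.
Hypothesis deg_le : forall x, (#|[set y | e x y]| <= D)%N.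
Hypothesis D_le : D%:R <= t ^+ m.-1.

(** Double counting of pairs (W, u) with [u] in [common W]: [u] is one of at most [D] neighbors of
    [x], and the other [j] elements of [W] are neighbors of [u]. *)
Lemma sum_codeg_le x j :
  (\sum_(W in [set W : {set T} | (x \in W) && (#|W| == j.+1)]) #|common W|
    <= D ^ j.+1)%N.
Proof.
set A := [set W | _].
have -> : (\sum_(W in A) #|common W| =
           \sum_u #|[set W in A | u \in common W]|)%N.
  under eq_bigr do rewrite -sum1_card big_mkcond /=.
  rewrite exchange_big /=; apply: eq_bigr => u _.
  rewrite -big_mkcondr /= -sum1_card; apply: eq_bigl => W.
  by rewrite [RHS]inE.
rewrite (bigID (mem [set u | e x u])) /= [X in (_ + X)%N]big1 ?addn0; last first.
  move=> u; rewrite inE => nxu; apply/eqP; rewrite cards_eq0; apply/eqP/setP => W.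
  rewrite !inE; apply/negP => /andP[/andP[xW _] /forall_inP uW]; have := uW x xW.
  by rewrite e_sym (negbTE nxu).
rewrite expnS; apply: (@leq_trans (\sum_(u in [set u | e x u]) D ^ j)%N); last first.
  by rewrite sum_nat_const leq_mul.
apply: leq_sum => u _.
apply: (@leq_trans #|[set B : {set T} | B \subset [set y | e u y] & #|B| == j]|).
  rewrite -[X in (X <= _)%N](card_in_imset (f := fun W => W :\ x)); last first.
    move=> W1 W2; rewrite !inE => /andP[/andP[x1 _] _] /andP[/andP[x2 _] _] E.
    by rewrite -(setD1K x1) -(setD1K x2) E.
  apply: subset_leq_card; apply/subsetP => _ /imsetP[W + ->].
  rewrite !inE => /andP[/andP[xW /eqP cW] /forall_inP uW].
  have := cardsD1 x W; rewrite xW cW => -[->]; rewrite eqxx andbT.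
  by apply/subsetP => y; rewrite !inE => /andP[_ /uW].
rewrite cards_draws; apply: leq_trans (bin_le_expn _ _) _.
by case: (j) => // k; rewrite leq_exp2r.
Qed.

(** Each heavy set accounts for at least t^(m-j-1) of the at most D^(j+1) <= t^((m-1)(j+1)) pairs;
    the quotient of the two powers is t^(mj). *)
Lemma card_heavy_at x j :
  #|heavy_at x j.+1|%:R <= (t ^+ m) ^+ j :> R.
Proof.
have tm0 : 0 < t ^+ m by rewrite exprn_gt0.
rewrite -(ler_pM2r tm0) -exprSr.
apply: (@le_trans _ _ ((\sum_(W in [set W : {set T} | (x \in W) && (#|W| == j.+1)])
   #|common W|)%:R * t ^+ j.+1)).
  rewrite natr_sum mulr_suml.
  apply: (@le_trans _ _ (\sum_(W in heavy_at x j.+1) #|common W|%:R * t ^+ j.+1)).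
    rewrite mulr_natl -sumr_const; apply: ler_sum => W; rewrite !inE.
    by move=> /and3P[_ /eqP <- /andP[_]].
  rewrite [leRHS](bigID (mem (heavy_at x j.+1))) /= ler_wpDr //.
    by apply: sumr_ge0 => W _; rewrite mulr_ge0 ?ler0n // exprn_ge0 // ltW.
  rewrite le_eqVlt; apply/orP; left; apply/eqP; apply: eq_bigl => W.
  by rewrite !inE; case: (x \in W); case: (#|W| == _); rewrite ?andbF.
apply: (@le_trans _ _ ((D ^ j.+1)%:R * t ^+ j.+1)).
  by rewrite ler_pM2r ?exprn_gt0 // ler_nat sum_codeg_le.
rewrite natrX -exprMn.
have le1 : D%:R * t <= t ^+ m.
  have -> : t ^+ m = t ^+ m.-1 * t by rewrite -exprSr; congr (_ ^+ _); lia.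
  by rewrite ler_pM2r.
by apply: lerXn2r; rewrite // nnegrE ?mulr_ge0 ?ler0n ?exprn_ge0 // ltW.
Qed.

End Heavy.

(* A rooted graph on an ordered vertex set, latest vertex first: each bitseq
   selects the neighbors of a vertex among the earlier ones; the root, which
   comes last, has no entry. *)
Definition pattern := seq bitseq.

Fixpoint wf_pattern (p : pattern) :=
  if p is B :: p' then [&& size B == (size p').+1, has id B & wf_pattern p']
  else true.

Definition edges (p : pattern) := \sum_(B <- p) count id B.

(** * Counting embeddings of a pattern with a prescribed root *)

Section Embeddings.
Local Open Scope ring_scope.

Variables (T : finType) (e : rel T) (R : realFieldType) (t : R) (m D : nat).
Hypothesis m_ge2 : (2 <= m)%N.
Hypothesis deg_le : forall x, (#|[set y | e x y]| <= D)%N.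
Hypothesis e_sym : symmetric e.
Hypothesis t_ge1 : 1 <= t.
Hypothesis D_le : D%:R <= t ^+ m.-1.

Let t_gt0 : 0 < t. Proof. exact: lt_le_trans ltr01 t_ge1. Qed.

(** Demanding that the images of the earlier neighbors be non-heavy is what limits the choices of
    [y]. *)
Definition extends (s : seq (T * bool)) (B : bitseq) (y : T) :=
  [&& all (e y) (unzip1 (mask B s)),
      ~~ heavy e t m [set z in unzip1 (mask B s)] & y \notin unzip1 s].

(* The boolean records the side of a vertex in the bipartition, false being the
   side of the root. *)
Fixpoint embeddings (x : T) (p : pattern) : seq (seq (T * bool)) :=
  if p is B :: p' then
    flatten [seq [seq (y, ~~ (head (x, false) (mask B s)).2) :: s
                 | y <- enum (extends s B)]
            | s <- embeddings x p']
  else [:: [:: (x, false)]].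

Lemma mem_embeddings x B p y b s :
  ((y, b) :: s \in embeddings x (B :: p)) =
  [&& s \in embeddings x p, extends s B y
    & b == ~~ (head (x, false) (mask B s)).2].
Proof.
apply/flatten_mapP/and3P => [[s' s'p /mapP[y' + [-> -> ->]]]|[sp sy /eqP ->]].
  by rewrite mem_enum => y's; split.
by exists s => //; apply/mapP; exists y; rewrite ?mem_enum.
Qed.

Lemma embeddingsP x p s : s \in embeddings x p ->
  [/\ uniq (unzip1 s), (x, false) \in s & size s = (size p).+1].
Proof.
elim: p s => [|B p IHp] s; first by rewrite inE => /eqP ->; rewrite mem_head.
case: s => [|[y b] s]; first by case/flatten_mapP => s' _ /mapP[].
rewrite mem_embeddings => /and3P[/IHp[us xs ss] /and3P[_ _ ys] _].
by rewrite /= ys us inE xs orbT ss.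
Qed.

(** For one earlier neighbor this is the degree bound D <= t^(m-1); for k >= 2 of them, a non-heavy
    k-set has fewer than t^(m-k) common neighbors. *)
Lemma card_extends s B : size s = size B -> uniq (unzip1 s) -> has id B ->
  #|extends s B|%:R * t ^+ count id B <= t ^+ m.
Proof.
move=> sB us hB; have sM : size (mask B s) = count id B by rewrite size_mask.
have uM : uniq (unzip1 (mask B s)) by rewrite /unzip1 map_mask mask_uniq.
have cM : #|[set z in unzip1 (mask B s)]| = count id B.
  by rewrite cardsE (card_uniqP uM) size_map.
have := hB; rewrite has_count -sM; case E : (mask B s) => [|z [|z' M]] // _.
  rewrite expr1; have -> : t ^+ m = t ^+ m.-1 * t.
    by rewrite -exprSr; congr (_ ^+ _); lia.
  rewrite ler_pM2r //; apply: le_trans D_le; rewrite ler_nat.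
  apply: leq_trans (deg_le z.1); apply: subset_leq_card.
  by apply/subsetP => y; rewrite inE => /and3P[]; rewrite E /= andbT e_sym.
have [->|/card_gt0P[y0 /and3P[_ nh _]]] := posnP #|extends s B|.
  by rewrite mul0r exprn_ge0 // ltW.
have M1 : (1 < size (mask B s))%N by rewrite E.
move: nh; rewrite /heavy cM -sM M1 /= -ltNge => /ltW; apply: le_trans.
have -> : (size M).+2 = size (mask B s) by rewrite E.
rewrite ler_pM2r ?exprn_gt0 // ler_nat; apply: subset_leq_card.
apply/subsetP => y => /and3P[/allP ye _ _]; rewrite inE.
by apply/forall_inP => w; rewrite inE => /ye.
Qed.

Lemma size_embeddings x p : wf_pattern p ->
  (size (embeddings x p))%:R * t ^+ edges p <= (t ^+ m) ^+ size p.
Proof.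
elim: p => [_|B p IHp /= /and3P[/eqP sB hB wp]].
  by rewrite /edges big_nil mulr1.
rewrite /edges big_cons -/(edges p) size_flatten /shape -map_comp sumnE big_map.
rewrite exprD exprS natr_sum mulrA mulrC !mulr_suml mulr_sumr.
apply: (@le_trans _ _ (\sum_(s <- embeddings x p) t ^+ edges p * t ^+ m)).
  rewrite big_seq [leRHS]big_seq; apply: ler_sum => s sp.
  have [us _ ss] := embeddingsP sp.
  rewrite ler_pM2l ?exprn_gt0 //= size_map -cardE.
  by apply: card_extends; rewrite ?ss ?sB.
rewrite big_const_seq count_predT iter_addr_0 -mulr_natl mulrA [leRHS]mulrC.
by rewrite ler_pM2r ?exprn_gt0 //; apply: IHp.
Qed.

Definition near x (s : seq (T * bool)) :=
  [seq z.1 | z <- s & ~~ z.2 && (z.1 != x)].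

Definition far (s : seq (T * bool)) := [seq z.1 | z <- s & z.2].

(* One vertex of each side is kept; that of the root's side differs from the
   root, which must belong to the first component. *)
Definition copy_event x (s : seq (T * bool)) : {set T} * {ffun T -> T} :=
  let k0 := head x (near x s) in
  let k1 := head x (far s) in
  ([set z in unzip1 s] :\: [set k0; k1],
   [ffun z => if (z, true) \in s then k1 else k0]).

Lemma near_head x s : near x s != [::] ->
  (head x (near x s), false) \in s /\ head x (near x s) != x.
Proof.
rewrite /near; case E : filter => [|[y b] s'] //= _.
have : (y, b) \in (y, b) :: s' by rewrite mem_head.
by rewrite -E mem_filter /= => /andP[/andP[/negbTE -> ->]].
Qed.

Lemma far_head x s : far s != [::] -> (head x (far s), true) \in s.
Proof.
rewrite /far; case E : filter => [|[y b] s'] //= _.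
have : (y, b) \in (y, b) :: s' by rewrite mem_head.
by rewrite -E mem_filter /= => /andP[->].
Qed.

Lemma unzip1_uniqP (s : seq (T * bool)) y b b' :
  uniq (unzip1 s) -> (y, b) \in s -> (y, b') \in s -> b = b'.
Proof.
elim: s => //= [[z c] s IHs] /andP[zs us]; rewrite !inE.
case/orP => [/eqP[E ->]|yb]; case/orP => [/eqP[E' ->]|yb'] //; last exact: IHs.
- by case/negP: zs; rewrite -E; apply/mapP; exists (y, b').
- by case/negP: zs; rewrite -E'; apply/mapP; exists (y, b).
Qed.

(** The representatives differ from the root and, lying on opposite sides, from each other; deleting
    them from the [(size p).+1] vertices leaves [(size p).-1]. *)
Lemma copy_eventP x p s : s \in embeddings x p ->
  near x s != [::] -> far s != [::] ->
  let ev := copy_event x s in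
  [/\ x \in ev.1, {in ev.1, forall z, ev.2 z \notin ev.1} & #|ev.1| = (size p).-1].
Proof.
move=> sp /near_head[k0s k0x] /(far_head x) k1s /=.
have [us xs ss] := embeddingsP sp.
move: (head x (near x s)) (head x (far s)) k0s k0x k1s => k0 k1 k0s k0x k1s.
have k01 : k0 != k1.
  by apply/eqP => E; have := unzip1_uniqP us k0s; rewrite E => /(_ _ k1s).
have k1x : k1 != x.
  by apply/eqP => E; have := unzip1_uniqP us xs; rewrite -E => /(_ _ k1s).
have in1 y b : (y, b) \in s -> y \in unzip1 s by move=> ys; apply/mapP; exists (y, b).
split.
- by rewrite !inE negb_or eq_sym k0x eq_sym k1x (in1 _ _ xs).
- by move=> z _; rewrite !ffunE; case: ifP => _; rewrite !inE eqxx ?orbT.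
have -> : #|[set z in unzip1 s] :\: [set k0; k1]| = (#|[set z in unzip1 s]| - 2)%N.
  rewrite cardsD (setIidPr _) ?cards2 ?k01 //.
  by apply/subsetP => z; rewrite !inE => /orP[] /eqP ->;
    [apply: in1 k0s|apply: in1 k1s].
have -> : #|[set z in unzip1 s]| = #|unzip1 s| by apply: eq_card => z; rewrite inE.
by rewrite (card_uniqP us) size_map ss subSS subn1.
Qed.

End Embeddings.

(** Pairs not selected by [p] are unconstrained: [s] exhibits [p] as a subgraph, not necessarily
    induced. *)
Fixpoint matches (A : eqType) (adj : rel A) (r : A) (p : pattern) (s : seq A) :=
  match p, s with
  | [::], [:: h] => h == r
  | B :: p', h :: s' =>
      [&& size B == size s', all (adj h) (mask B s') & matches adj r p' s']
  | _, _ => false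
  end.

Lemma matches_root (A : eqType) (adj : rel A) r p s :
  matches adj r p s -> r \in s.
Proof.
elim: p s => [|B p IHp] [|h s] //=.
  by case: s => // /eqP ->; rewrite mem_head.
by case/and3P => _ _ /IHp rs; rewrite inE rs orbT.
Qed.

Lemma matches_size (A : eqType) (adj : rel A) r p s :
  matches adj r p s -> size s = (size p).+1.
Proof.
elim: p s => [|B p IHp] [|h s] //=; first by case: s.
by case/and3P => _ _ /IHp ->.
Qed.

(** * The events for proper, heavy-free, copy-free colorings, and their cost *)

Section Existence.
Local Open Scope ring_scope.

Variables (F : ograph -> Prop) (T : finType) (e : rel T).
Variables (R : realFieldType) (t b : R) (m D c : nat) (L : seq pattern).
Hypothesis m_ge2 : (2 <= m)%N.
Hypothesis e_sym : symmetric e.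
Hypothesis e_irr : irreflexive e.
Hypothesis deg_le : forall x, (#|[set y | e x y]| <= D)%N.
Hypothesis t_ge1 : 1 <= t.
Hypothesis b_ge1 : 1 <= b.
Hypothesis D_le : D%:R <= t ^+ m.-1.
Hypothesis L_wf : forall p, p \in L -> wf_pattern p && (m <= edges p)%N.
Hypothesis F_nonempty : forall H, F H -> (0 < fg_n H)%N.
Hypothesis L_cover : forall H, F H -> forall r : 'I_(fg_n H),
  exists p s, [/\ p \in L, uniq s & matches (fg_adj H) r p s].

Let t_gt0 : 0 < t. Proof. exact: lt_le_trans ltr01 t_ge1. Qed.
Let b_gt0 : 0 < b. Proof. exact: lt_le_trans ltr01 b_ge1. Qed.
Local Notation heavy := (heavy e t m).

Section Coloring.
Variable c0 : 'I_c.
Implicit Types (f : {ffun T -> 'I_c}) (V W : {set T}).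

Definition properb V f :=
  [forall y in V, forall z in V, e y z ==> (f y != f z)].

Definition mono W f := [forall y in W, forall z in W, f y == f z].

Definition no_mono_heavy V f :=
  [forall W : {set T}, (W \subset V) && heavy W ==> ~~ mono W f].

Definition bicolored_copy V f :=
  exists H (phi : 'I_(fg_n H) -> T) (i j : 'I_c),
    [/\ F H, injective phi, forall a, phi a \in V,
        forall a a', fg_adj H a a' -> e (phi a) (phi a')
      & forall a, (f (phi a) == i) || (f (phi a) == j)].

Definition good V f :=
  [&& properb V f, no_mono_heavy V f & ~~ `[< bicolored_copy V f >]].

Lemma good_restr V W f : W \subset V -> good V f -> good W (restr c0 W f).
Proof.
move=> /subsetP sWV /and3P[fp fh fc].
have rE y : y \in W -> restr c0 W f y = f y by move=> yW; rewrite ffunE yW.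
apply/and3P; split.
- apply/forall_inP => y yW; apply/forall_inP => z zW; rewrite !rE //.
  by have /forall_inP/(_ y (sWV _ yW))/forall_inP/(_ z (sWV _ zW)) := fp.
- apply/forallP => U; apply/implyP => /andP[/subsetP UW hU].
  have UV : U \subset V by apply/subsetP => y /UW/sWV.
  have /forallP/(_ U) := fh; rewrite UV hU /=; apply: contra => /forall_inP mU.
  apply/forall_inP => y yU; apply/forall_inP => z zU.
  by rewrite -!rE ?UW //; have /forall_inP := mU y yU; apply.
apply: contra fc => /asboolP[H [phi [i [j [FH iphi phiW ephi cphi]]]]].
apply/asboolP; exists H, phi, i, j; split => // [a|a]; first exact/sWV/phiW.
by rewrite -(rE (phi a)).
Qed.

(** The representative avoids [x], which has to be redundant; the default of [odflt] is never
    reached when [W] has two elements. *)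
Definition heavy_event x W : {set T} * {ffun T -> T} :=
  let y := odflt x [pick y in W :\ x] in (W :\ y, [ffun=> y]).

Definition edge_events x : seq ({set T} * {ffun T -> T}) :=
  [seq ([set x], [ffun=> y]) | y <- enum (e x)].

(** The shift by 2 makes j < m - 1 in [events] cover the sizes 2 to m. *)
Definition heavy_events x j :=
  [seq heavy_event x W | W <- enum (heavy_at e t m x j.+2)].

(** The filter keeps the embeddings for which both representatives exist; [events_copy] shows that
    the others cannot come from a bicolored copy in the absence of monochromatic heavy sets. *)
Definition copy_events x p :=
  [seq copy_event x s | s <- embeddings e t m x p
                      & (near x s != [::]) && (far s != [::])].

Definition events x :=
  edge_events x ++ flatten [seq heavy_events x j | j <- iota 0 m.-1]
  ++ flatten [seq copy_events x p | p <- L].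

Lemma heavy_eventP x W : x \in W -> (1 < #|W|)%N ->
  exists y, [/\ y \in W, y != x & heavy_event x W = (W :\ y, [ffun=> y])].
Proof.
move=> xW W1; rewrite /heavy_event; case: pickP => [y|W0].
  by rewrite !inE => /andP[yx yW]; exists y.
have := cardsD1 x W; rewrite xW (_ : W :\ x = set0) ?cards0; first by lia.
by apply/setP => z; rewrite [RHS]inE; apply: W0.
Qed.

Lemma events_wf x ev : ev \in events x ->
  x \in ev.1 /\ {in ev.1, forall z, ev.2 z \notin ev.1}.
Proof.
rewrite !mem_cat => /or3P[/mapP[y]|/flatten_mapP[j _ /mapP[W]]
                         |/flatten_mapP[p _ /mapP[s]]].
- rewrite mem_enum => exy -> /=; rewrite set11; split=> // z _.
  by rewrite ffunE inE; apply: contraTneq exy => ->; rewrite -topredE /= e_irr.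
- rewrite mem_enum inE => /and3P[xW /eqP cW _] ->.
  have [|y [yW yx ->]] := heavy_eventP xW; first by rewrite cW.
  rewrite /= !inE eq_sym yx xW; split=> // z _.
  by rewrite ffunE !inE eqxx.
by rewrite mem_filter => /andP[/andP[ns fs] sp] ->; have [] := copy_eventP sp ns fs.
Qed.

(** With N = t^m, at most N^(size p) / t^(edges p) embeddings cost (b N)^-(size p - 2) each. *)
Lemma embeddings_cost x p : wf_pattern p ->
  \sum_(ev <- copy_events x p) (b * t ^+ m) ^- #|ev.1|.-1 <=
  (t ^+ m) ^+ 2 / (t ^+ edges p * b ^+ (size p - 2)).
Proof.
move=> wp; have N0 : 0 < t ^+ m by rewrite exprn_gt0.
have den0 : 0 < t ^+ edges p * b ^+ (size p - 2) by rewrite mulr_gt0 ?exprn_gt0.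
(* Below size 2 the subtraction truncates, but then no event exists: its set would be empty and yet
   contain [x]. *)
have [p2|p1] := leqP 2 (size p); last first.
  rewrite /copy_events (_ : [seq s <- _ | _] = [::]) /= ?big_nil.
    by rewrite divr_ge0 ?exprn_ge0 ?(ltW N0) // ltW.
  apply/eqP; rewrite -[_ == _]negbK -has_filter; apply/hasPn => s sp.
  apply/negP => /andP[ns fs].
  have [xS rS cS] := copy_eventP sp ns fs.
  have : (0 < #|(copy_event x s).1|)%N by apply/card_gt0P; exists x.
  by rewrite cS; case: (size p) p1 => [|[|]].
rewrite big_map big_filter big_seq_cond.
apply: (@le_trans _ _ (\sum_(s <- embeddings e t m x p) (b * t ^+ m) ^- (size p - 2))).
  rewrite [leRHS](bigID (fun s => (s \in embeddings e t m x p) &&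
                                  ((near x s != [::]) && (far s != [::])))) /=.
  rewrite ler_wpDr //.
    by apply: sumr_ge0 => s _; rewrite invr_ge0 exprn_ge0 // mulr_ge0 ?(ltW N0) // ltW.
  apply: ler_sum => s /andP[sp /andP[ns fs]].
  by have [_ _ ->] := copy_eventP sp ns fs; rewrite -subn2 // -!subn1 subnA.
rewrite big_const_seq count_predT iter_addr_0 -mulr_natl.
rewrite exprMn invfM ler_pdivlMr //.
have le1 := size_embeddings m_ge2 deg_le e_sym t_ge1 D_le x wp.
have -> : (size (embeddings e t m x p))%:R *
    (b ^- (size p - 2) * (t ^+ m) ^- (size p - 2))
    * (t ^+ edges p * b ^+ (size p - 2)) =
  (size (embeddings e t m x p))%:R * t ^+ edges p * (t ^+ m) ^- (size p - 2).
  field; rewrite !expf_neq0 ?gt_eqF //.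
rewrite ler_pdivrMr ?exprn_gt0 // -exprD.
by rewrite (_ : (2 + (size p - 2) = size p)%N) // subnKC.
Qed.

(** There are at most N^(j+1) heavy sets, and each has j + 1 redundant vertices, hence costs (b
    N)^-j. *)
Lemma heavy_cost x j :
  \sum_(ev <- heavy_events x j) (b * t ^+ m) ^- #|ev.1|.-1 <= t ^+ m.
Proof.
have N0 : 0 < t ^+ m by rewrite exprn_gt0.
rewrite big_map big_enum.
apply: (@le_trans _ _ (\sum_(W in heavy_at e t m x j.+2) (b * t ^+ m) ^- j)).
  apply: ler_sum => W; rewrite inE => /and3P[xW /eqP cW _].
  have [|y [yW _ ->]] := heavy_eventP xW; first by rewrite cW.
  by have := cardsD1 y W; rewrite yW cW /= add1n => -[<-].
rewrite sumr_const -[leLHS]mulr_natl ler_pdivrMr ?exprn_gt0 ?mulr_gt0 //.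
apply: le_trans (card_heavy_at m_ge2 t_ge1 e_sym deg_le D_le x j.+1) _.
rewrite exprMn exprS ler_pM2l // ler_peMl ?exprn_ge0 ?(ltW t_gt0) //.
exact: exprn_ege1.
Qed.

Lemma events_cost x :
  b * t ^+ m + D%:R + (m.-1)%:R * t ^+ m
    + \sum_(p <- L) (t ^+ m) ^+ 2 / (t ^+ edges p * b ^+ (size p - 2)) <= c%:R ->
  b * t ^+ m + \sum_(ev <- events x) (b * t ^+ m) ^- #|ev.1|.-1 <= c%:R.
Proof.
apply: le_trans; rewrite !big_cat /= -!addrA lerD2l; apply: lerD; last apply: lerD.
- rewrite big_map (eq_bigr (fun=> 1)); last by move=> y _; rewrite cards1 expr0 invr1.
  rewrite big_const_seq count_predT iter_addr_0 -cardE ler_nat.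
  apply: leq_trans (deg_le x); apply: subset_leq_card.
  by apply/subsetP => y; rewrite inE.
- rewrite big_flatten big_map /=.
  apply: (@le_trans _ _ (\sum_(j <- iota 0 m.-1) t ^+ m)).
    by apply: ler_sum => j _; apply: heavy_cost.
  by rewrite big_const_seq count_predT iter_addr_0 size_iota mulr_natl.
rewrite big_flatten big_map /= big_seq [leRHS]big_seq; apply: ler_sum => p pL.
by apply: embeddings_cost; have /andP[] := L_wf pL.
Qed.

(** Listing the copy along a pattern rooted at the preimage of [x] gives a member of [embeddings],
    whose copy event is obeyed because vertices on the same side have the same color. *)
Lemma events_copy V x f H (phi : 'I_(fg_n H) -> T) (i j : 'I_c) r :
  properb (x |: V) f -> no_mono_heavy (x |: V) f ->
  F H -> injective phi -> (forall a, phi a \in x |: V) ->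
  (forall a a', fg_adj H a a' -> e (phi a) (phi a')) ->
  (forall a, (f (phi a) == i) || (f (phi a) == j)) ->
  phi r = x ->
  has (fun ev : {set T} * {ffun T -> T} => (ev.1 \subset x |: V) && obeys f ev)
    (events x).
Proof.
move=> fp fh FH iphi phiV ephi cphi phir.
have [p [s [pL us mps]]] := L_cover FH r.
have /andP[wp mp] := L_wf pL.
(* With two colors available, a third vertex disagrees with exactly one of two differently colored
   ones. *)
have two a1 a2 a3 : f (phi a1) != f (phi a2) ->
    (f (phi a1) != f (phi a3)) = ~~ (f (phi a2) != f (phi a3)).
  rewrite negbK; case/orP: (cphi a1) => /eqP ->; case/orP: (cphi a2) => /eqP ->;
    case/orP: (cphi a3) => /eqP ->; rewrite ?eqxx // => n12;
    by rewrite ?n12 // eq_sym (negbTE n12).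
have neq a1 a2 : fg_adj H a1 a2 -> f (phi a1) != f (phi a2).
  move=> /ephi e12; move/forall_inP: fp => /(_ _ (phiV a1))/forall_inP/(_ _ (phiV a2)).
  by rewrite e12.
pose g h := (phi h, f (phi h) != f x).
have emb : map g s \in embeddings e t m x p.
  elim: (p) (s) us wp mps {pL mp} => [|B q IHq] [|h s'] //=.
    by case: s' => // _ _ /eqP ->; rewrite /g phir eqxx inE.
  move=> /andP[hs' us'] /and3P[_ hB wq] /and3P[/eqP sB /allP Bh mq].
  rewrite -/(embeddings e t m x (B :: q)) mem_embeddings IHq //=.
  rewrite -map_mask; have maskE : unzip1 (map g (mask B s')) = map phi (mask B s').
    by rewrite /unzip1 -map_comp.
  apply/andP; split; last first.
    have : (0 < size (mask B s'))%N by rewrite size_mask // -has_count.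
    case E : (mask B s') => [|z M] //= _.
    have hz : f (phi h) != f (phi z) by apply/neq/Bh; rewrite E mem_head.
    by rewrite -phir (two _ _ r hz).
  rewrite /extends -map_mask maskE; apply/and3P; split.
  - by apply/allP => _ /mapP[z /Bh hz ->]; apply: ephi.
  (* All earlier neighbors carry the color opposite to that of [h], so they are monochromatic and
     hence not heavy. *)
  - apply/negP => hW; have /forallP/(_ [set z in map phi (mask B s')]) := fh.
    rewrite hW andbT; apply/negP; rewrite negb_imply negbK; apply/andP; split.
      by apply/subsetP => y; rewrite inE => /mapP[z _ ->].
    apply/forall_inP => y1; rewrite inE => /mapP[z1 /Bh/neq n1 ->].
    apply/forall_inP => y2; rewrite inE => /mapP[z2 /Bh/neq n2 ->].
    by rewrite eq_sym in n1; have := two _ _ z2 n1; rewrite n2 /= => /negbFE.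
  - rewrite /unzip1 -map_comp; apply/negP => /mapP[z zs' /iphi E].
    by rewrite E zs' in hs'.
(* If the root is alone on its side, the other vertices are its neighbors and
   form a monochromatic heavy set. *)
suff [ns fs] : near x (map g s) != [::] /\ far (map g s) != [::].
  apply/hasP; exists (copy_event x (map g s)).
    rewrite mem_cat mem_cat; apply/orP; right; apply/orP; right.
    apply/flatten_mapP; exists p => //; apply/mapP; exists (map g s) => //.
    by rewrite mem_filter ns fs.
  have [k0s _] := near_head ns; have k1s := far_head x fs.
  apply/andP; split.
    apply/subsetP => y; rewrite !inE => /andP[_]; rewrite /unzip1 -map_comp.
    by case/mapP => z _ -> /=; have := phiV z; rewrite !inE.
  have gP y d : (y, d) \in map g s -> exists2 h, y = phi h & d = (f y != f x).
    by case/mapP => h _ [-> ->]; exists h.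
  have [h0 E0 F0] := gP _ _ k0s; have [h1 E1 F1] := gP _ _ k1s.
  apply/forall_inP => z /=; rewrite inE => /andP[_]; rewrite inE ffunE.
  case/mapP => -[y d] ys /= ->; have [hy Ey Fy] := gP _ _ ys.
  case: ifP => [ys'|/negP ys'].
    have := embeddingsP emb; case=> uu _ _.
    have := unzip1_uniqP uu ys ys' => dT; move: Fy F1; rewrite dT E1 Ey -phir.
    move=> /esym n1 /esym n2; have := two _ _ h1 n1; rewrite (eq_sym (f (phi r))) n2.
    by move=> /negbFE ->.
  move: Fy; case: d ys => // _ /esym/negbFE/eqP ->.
  by move: F0 => /esym/negbFE/eqP ->.
(* Since m >= 2 the pattern has an entry; its latest vertex and an earlier neighbor are on opposite
   sides, so [far] is nonempty. *)
split; last first.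
  case: (p) (map g s) emb wp mp => [|B q] s'.
    by rewrite /edges big_nil; case: (m) m_ge2.
  case: s' => [|[y d] s']; first by case/flatten_mapP => ? _ /mapP[].
  rewrite mem_embeddings => /and3P[s'q _ /eqP ->] /and3P[/eqP sB hB _] _.
  rewrite /far /=; case: ifP => //= /negbFE hd.
  have [_ _ ss'] := embeddingsP s'q.
  have : (0 < size (mask B s'))%N by rewrite size_mask -?has_count // ss' sB.
  case E : (mask B s') hd => [|[z c'] M] //= hd _; rewrite hd in E.
  rewrite -[_ == _]negbK -size_eq0 size_map size_filter -lt0n -has_count negbK.
  apply/hasPn => /(_ (z, true)) nz.
  by have /nz : (z, true) \in s' by apply: (@mem_mask _ _ B); rewrite E mem_head.
apply/negP => near0.
have nearN h : h \in s -> h != r -> f (phi h) != f x.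
  move=> hs hr; apply/negP => fE.
  have : phi h \in near x (map g s); last by rewrite (eqP near0).
  apply/mapP; exists (g h) => //; rewrite mem_filter map_f // andbT /= fE /=.
  by rewrite -phir; apply: contra hr => /eqP/iphi ->.
(* All vertices but the root share one color, so each entry can select the root only and contributes
   a single edge; this yields at least [m] leaves. *)
have star : (edges p <= size p)%N /\ forall h, h \in s -> h != r -> e (phi h) x.
  elim: (p) (s) us wp mps nearN {pL mp emb near0} => [|B q IHq] [|h s'] //=.
    case: s' => // _ _ /eqP -> _; rewrite /edges big_nil; split=> // h'.
    by rewrite inE => /eqP ->; rewrite eqxx.
  move=> /andP[hs' us'] /and3P[_ hB wq] /and3P[/eqP sB /allP Bh mq] nearN.
  have [|le1 sr] := IHq s' us' wq mq.
    by move=> h' hs; apply: nearN; rewrite inE hs orbT.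
  have hr : h != r by apply: contraNneq hs' => ->; apply: matches_root mq.
  have onlyr z : z \in mask B s' -> z = r.
    move=> zM; apply/eqP; apply: contraT => zr.
    have nz : f (phi z) != f x by apply: nearN => //; rewrite inE (mem_mask zM) orbT.
    have nh : f (phi h) != f x by apply: nearN => //; rewrite mem_head.
    have := two _ _ r (neq _ _ (Bh _ zM)); rewrite phir nz nh //.
  have M1 : (count id B <= 1)%N.
    rewrite -(size_mask sB) -[1%N]/(size [:: r]); apply: uniq_leq_size.
      exact: mask_uniq.
    by move=> z /onlyr ->; rewrite mem_head.
  split; first by rewrite /edges big_cons; apply: leq_add M1 le1.
  move=> h'; rewrite inE => /orP[/eqP -> _|]; last exact: sr.
  have : (0 < size (mask B s'))%N by rewrite size_mask // -has_count.
  case E : (mask B s') => [|z M] // _.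
  have zM : z \in mask B s' by rewrite E mem_head.
  by rewrite -phir -(onlyr _ zM); apply/ephi/Bh.
have [le1 sr] := star.
pose W := [set y in map phi [seq h <- s | h != r]].
have cW : #|W| = size p.
  rewrite cardsE (card_uniqP _) ?map_inj_uniq ?filter_uniq // size_map size_filter.
  have := count_predC (pred1 r) s; rewrite (matches_size mps).
  by rewrite (count_uniq_mem _ us) (matches_root mps) add1n => -[].
have WP y : y \in W -> exists2 h, y = phi h & (h \in s) && (h != r).
  by rewrite inE => /mapP[h]; rewrite mem_filter andbC => hP ->; exists h.
have mp' : (m <= #|W|)%N by rewrite cW (leq_trans mp).
have hW : heavy W.
  apply: (@heavy_of_common _ _ _ _ _ t_ge1 _ x) => //; last exact: leq_trans mp'.
  rewrite inE; apply/forall_inP => y /WP[h -> /andP[hs hr]].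
  by rewrite e_sym; apply: sr.
have /forallP/(_ W) := fh; rewrite hW andbT; apply/negP; rewrite negb_imply negbK.
apply/andP; split; first by apply/subsetP => y /WP[h -> _].
apply/forall_inP => y1 /WP[h1 -> /andP[s1 n1]].
apply/forall_inP => y2 /WP[h2 -> /andP[s2 n2]].
have n1' := nearN _ s1 n1; have n2' := nearN _ s2 n2; rewrite -phir in n1' n2'.
by have := two _ _ h2 n1'; rewrite (eq_sym (f (phi r))) n2' /= => /negbFE.
Qed.

(** Any violation involves [x], as [V] itself is good. Copies are treated last because [events_copy]
    relies on the absence of the other two violations. *)
Lemma events_cover (V : {set T}) x f : x \notin V ->
  good V (restr c0 V f) -> ~~ good (x |: V) f ->
  has (fun ev : {set T} * {ffun T -> T} => (ev.1 \subset x |: V) && obeys f ev)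
    (events x).
Proof.
move=> xV /and3P[fp fh fc]; rewrite /good.
have rE y : y \in V -> restr c0 V f y = f y by move=> yV; rewrite ffunE yV.
have [fpx|nfpx] := boolP (properb (x |: V) f) => /=; last first.
  move=> _.
  have clash y : y \in V -> e x y -> f x == f y ->
      has (fun ev : {set T} * {ffun T -> T} => (ev.1 \subset x |: V) && obeys f ev)
    (events x).
    move=> yV exy fxy; apply/hasP; exists ([set x], [ffun=> y]).
      by rewrite mem_cat; apply/orP; left; apply/mapP; exists y; rewrite ?mem_enum.
    rewrite sub1set setU11 /=; apply/forall_inP => z /=.
    by rewrite inE ffunE => /eqP ->.
  move: nfpx; rewrite negb_forall_in => /exists_inP[y + ].
  rewrite negb_forall_in => + /exists_inP[z].
  rewrite !inE negb_imply negbK => yxV zxV /andP[eyz fyz].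
  case/orP: yxV eyz fyz => [/eqP ->|yV]; case/orP: zxV => [/eqP ->|zV].
  - by rewrite e_irr.
  - by move=> exz fxz; apply: (clash z).
  - by move=> eyx fyx; apply: (clash y) => //; rewrite 1?e_sym // eq_sym.
  move=> eyz; have /forall_inP/(_ y yV)/forall_inP/(_ z zV) := fp.
  by rewrite eyz !rE //= => /negbTE ->.
have [fhx|nfhx] := boolP (no_mono_heavy (x |: V) f) => /=; last first.
  move=> _; move: nfhx; rewrite negb_forall => /existsP[W].
  rewrite negb_imply negbK => /andP[/andP[/subsetP WV hW] /forall_inP mW].
  have xW : x \in W.
    apply: contraT => xW; have WsV : W \subset V.
      apply/subsetP => y yW; have := WV y yW; rewrite !inE.
      by case: eqP => // E; rewrite -E yW in xW.
    have /forallP/(_ W) := fh; rewrite WsV hW /=.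
    apply: contraNT => _; apply/forall_inP => y yW; apply/forall_inP => z zW.
    by rewrite !rE ?(subsetP WsV) //; have /forall_inP := mW y yW; apply.
  have [W' [W'W xW' hW' cW']] := heavy_subset m_ge2 t_ge1 hW xW.
  have W'1 : (1 < #|W'|)%N by have /andP[] := hW'.
  have [y [yW' yx evE]] := heavy_eventP xW' W'1.
  apply/hasP; exists (heavy_event x W').
    rewrite mem_cat mem_cat; apply/orP; right; apply/orP; left.
    have [k kE] : exists k, #|W'| = k.+2.
      by case: #|W'| W'1 => [|[|k]] // _; exists k.
    apply/flatten_mapP; exists k.
      by rewrite mem_iota add0n /= ltn_predRL -kE.
    by apply/mapP; exists W' => //; rewrite mem_enum inE xW' kE eqxx.
  rewrite evE; apply/andP; split => /=.
    by apply/subsetP => z; rewrite !inE => /andP[_ /(subsetP W'W)/WV]; rewrite !inE.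
  apply/forall_inP => z; rewrite inE ffunE => /andP[_ zW'].
  have /forall_inP := mW z (subsetP W'W _ zW'); apply; exact: (subsetP W'W).
rewrite negbK => /asboolP[H [phi [i [j [FH iphi phiV ephi cphi]]]]].
have [/existsP[r /eqP phir]|nr] := boolP [exists r, phi r == x].
  exact: (@events_copy V x f H phi i j r).
case/negP: fc; apply/asboolP; exists H, phi, i, j; split=> // [a|a].
  have := phiV a; rewrite !inE; case: eqP => // E.
  by case/negP: nr; apply/existsP; exists a; apply/eqP.
rewrite rE //; have := phiV a; rewrite !inE; case: eqP => // E.
by case/negP: nr; apply/existsP; exists a; apply/eqP.
Qed.

End Coloring.

Lemma exists_2F_coloring :
  b * t ^+ m + D%:R + (m.-1)%:R * t ^+ m
    + \sum_(p <- L) (t ^+ m) ^+ 2 / (t ^+ edges p * b ^+ (size p - 2)) <= c%:R ->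
  exists col : T -> 'I_c, is_2F_coloring F e col.
Proof.
move=> cost; have N0 : 0 < t ^+ m by rewrite exprn_gt0.
have c_gt0 : (0 < c)%N.
  rewrite -(ltr0n R); apply: lt_le_trans cost.
  have S0 : 0 <= \sum_(p <- L) (t ^+ m) ^+ 2 / (t ^+ edges p * b ^+ (size p - 2)).
    apply: sumr_ge0 => p _; rewrite divr_ge0 ?mulr_ge0 ?exprn_ge0 //; exact: ltW.
  have D0 : 0 <= D%:R :> R by [].
  have bN : 0 < b * t ^+ m by rewrite mulr_gt0.
  have mN : 0 <= (m.-1)%:R * t ^+ m by rewrite mulr_ge0 // ltW.
  lra.
pose c0 := Ordinal c_gt0.
have [||f] := @exists_good T c c0 good (good_restr c0) R (b * t ^+ m) events _
   events_wf (@events_cover c0) (fun x => events_cost x cost).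
- by rewrite mulr_gt0.
- apply/and3P; split.
  + by apply/forall_inP => y; rewrite inE.
  + apply/forallP => W; rewrite subset0; apply/implyP => /andP[/eqP -> /andP[]].
    by rewrite cards0.
  apply/asboolP => -[H [phi [i [j [FH _ phi0 _ _]]]]].
  by have := phi0 (Ordinal (F_nonempty FH)); rewrite inE.
move=> /and3P[fp _ fc]; exists f; split=> [x y exy|i j _ H FH [phi [iphi [cphi ephi]]]].
  by have /forall_inP/(_ x (in_setT x))/forall_inP/(_ y (in_setT y)) := fp; rewrite exy.
by case/negP: fc; apply/asboolP; exists H, phi, i, j; split=> // a; rewrite in_setT.
Qed.

End Existence.

(** * Connected orderings of a graph and their patterns *)

Section Orderings.
Variables (A : finType) (adj : rel A).

(** All earlier neighbors are recorded, so the pattern is the induced subgraph on [s]. *)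
Fixpoint pattern_of (s : seq A) : pattern :=
  match s with
  | h :: ((_ :: _) as s') => map (adj h) s' :: pattern_of s'
  | _ => [::]
  end.

(* s lists, latest first, a connected vertex set explored from r. *)
Fixpoint grown (r : A) (s : seq A) :=
  match s with
  | h :: ((_ :: _) as s') => [&& h \notin s', has (adj h) s' & grown r s']
  | [:: h] => h == r
  | _ => false
  end.

Lemma grown_cons r h s : s != [::] ->
  grown r (h :: s) = [&& h \notin s, has (adj h) s & grown r s].
Proof. by case: s => [|a s]; rewrite ?eqxx. Qed.

Lemma pattern_of_cons h s : s != [::] ->
  pattern_of (h :: s) = map (adj h) s :: pattern_of s.
Proof. by case: s => [|a s]; rewrite ?eqxx. Qed.

Lemma grown_root r s : grown r s -> r \in s.
Proof.
elim: s => // h s IHs; have [->|sN] := eqVneq s [::].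
  by move=> /= /eqP ->; rewrite mem_head.
by rewrite grown_cons // => /and3P[_ _ /IHs rs]; rewrite inE rs orbT.
Qed.

Lemma grown_uniq r s : grown r s -> uniq s.
Proof.
elim: s => // h s IHs; have [->//|sN] := eqVneq s [::].
by rewrite grown_cons //= => /and3P[-> _ /IHs].
Qed.

Lemma size_pattern_of s : size (pattern_of s) = (size s).-1.
Proof.
elim: s => // h s IHs; have [->//|sN] := eqVneq s [::].
by rewrite pattern_of_cons //= IHs prednK // lt0n size_eq0.
Qed.

Lemma wf_pattern_of r s : grown r s -> wf_pattern (pattern_of s).
Proof.
elim: s => // h s IHs; have [->//|sN] := eqVneq s [::].
rewrite grown_cons // => /and3P[_ hs /IHs ws].
rewrite pattern_of_cons //= ws size_map size_pattern_of prednK ?lt0n ?size_eq0 //.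
by rewrite eqxx has_map /= (eq_has (a2 := adj h)) // hs.
Qed.

Lemma matches_pattern_of r s : grown r s -> matches adj r (pattern_of s) s.
Proof.
elim: s => // h s IHs; have [->//|sN] := eqVneq s [::].
rewrite grown_cons // => /and3P[_ hs /IHs ws].
by rewrite pattern_of_cons //= size_map eqxx ws -filter_mask filter_all.
Qed.

(** A path from the root to a missed vertex has a first vertex outside [s], which can be
    attached. *)
Lemma grown_extend r s : (forall x y, connect adj x y) -> symmetric adj ->
  grown r s -> (size s < #|A|)%N -> exists h, grown r (h :: s).
Proof.
move=> conn sym gs ss; have rs := grown_root gs.
have [y ys] : exists y, y \notin s.
  apply/existsP; rewrite -negb_forall; apply/negP => /forallP all_s.
  have := card_uniqP (grown_uniq gs); rewrite (eq_card (B := A)) => [E|y].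
    by rewrite E ltnn in ss.
  by rewrite all_s.
have sN : s != [::] by case: (s) rs.
have /connectP[p pp yE] := conn r y.
suff [h hs ha] : exists2 h, h \notin s & has (adj h) s.
  by exists h; rewrite grown_cons // hs ha.
elim: p r rs pp yE {gs} => [|z p IHp] r rs /=; first by move=> _ E; rewrite E rs in ys.
case/andP => rz pz yE; have [zs|zs] := boolP (z \in s); first exact: IHp zs pz yE.
by exists z => //; apply/hasP; exists r; rewrite // sym.
Qed.

Lemma exists_grown r k : (forall x y, connect adj x y) -> symmetric adj ->
  (k < #|A|)%N -> exists2 s, grown r s & size s = k.+1.
Proof.
move=> conn sym; elim: k => [|k IHk] kA; first by exists [:: r] => /=.
have [s gs ss] := IHk (ltnW kA).
have [|h gh] := grown_extend conn sym gs; first by rewrite ss.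
by exists (h :: s); rewrite //= ss.
Qed.

(** The handshake identity inside [s]. *)
Lemma edges_pattern_of r s : irreflexive adj -> symmetric adj -> grown r s ->
  (edges (pattern_of s)).*2 = \sum_(x <- s) count (adj x) s.
Proof.
move=> irr sym; elim: s => // h s IHs; have [->|sN] := eqVneq s [::].
  by move=> _; rewrite /edges big_nil big_cons big_nil /= irr.
rewrite grown_cons // => /and3P[_ _ /IHs IH].
rewrite pattern_of_cons // /edges [in LHS]big_cons doubleD -/(edges _) IH.
rewrite big_cons /= irr.
rewrite count_map (eq_count (a2 := adj h)) // big_split /=.
rewrite -addnn -!addnA; congr (_ + (_ + _))%N.
by rewrite -sumn_count sumnE big_map; apply: eq_bigr => y _; rewrite sym.
Qed.

End Orderings.

(** * Edge counts, and families of patterns covering a graph from every root *)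

Lemma edges_ge_size p : wf_pattern p -> (size p <= edges p)%N.
Proof.
elim: p => // B p IHp /= /and3P[_ hB wp]; rewrite /edges big_cons -add1n.
by apply: leq_add (IHp wp); rewrite -has_count.
Qed.

Lemma edges_full (H : ograph) (r : 'I_(fg_n H)) s : simple_fg H ->
  grown (fg_adj H) r s -> size s = fg_n H ->
  edges (pattern_of (fg_adj H) s) = fg_edges H.
Proof.
move=> [sym irr] gs ss; apply: double_inj; rewrite (edges_pattern_of irr sym gs).
have us := grown_uniq gs.
have all_s x : x \in s.
  have : #|s| = #|'I_(fg_n H)| by rewrite (card_uniqP us) card_ord.
  by move=> E; have /(_ x) := subset_cardP E (subset_predT _).
have sum_s (g : 'I_(fg_n H) -> nat) : \sum_(x <- s) g x = \sum_x g x.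
  by rewrite big_uniq //; apply: eq_bigl => x; rewrite all_s.
rewrite sum_s; under eq_bigr => x _ do rewrite -sumn_count sumnE big_map sum_s.
rewrite pair_big /= -addnn
  (bigID (fun p : 'I_(fg_n H) * 'I_(fg_n H) => (p.1 < p.2)%N)) /=.
rewrite /fg_edges -sum1dep_card big_mkcondl /=; congr (_ + _)%N.
have swap_inj : injective (fun p : 'I_(fg_n H) * 'I_(fg_n H) => (p.2, p.1)).
  by move=> [a b] [c d] [-> ->].
(* Ordered adjacent pairs split into increasing ones and their reversals, which are equally many. *)
rewrite (reindex_inj swap_inj) /=.
rewrite big_mkcond [RHS]big_mkcond; apply: eq_bigr => -[x y] _ /=.
rewrite (sym y x) -leqNgt leq_eqVlt; have [E|] := eqVneq (x : nat) y.
  by rewrite (val_inj E) irr ltnn.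
by rewrite /=; case: fg_adj; case: ltnP.
Qed.

(** Recursive trees: an entry of length n has one bit set, at one of n positions, whence n! of
    them. *)
Fixpoint tree_patterns n : seq pattern :=
  if n is n'.+1 then
    [seq mkseq (pred1 i) n :: p | i <- iota 0 n, p <- tree_patterns n']
  else [:: [::]].

Lemma size_tree_patterns n : size (tree_patterns n) = n`!.
Proof. by elim: n => // n IHn; rewrite size_allpairs size_iota IHn factS. Qed.

Lemma tree_patternsP n p : p \in tree_patterns n ->
  [/\ wf_pattern p, edges p = n & size p = n].
Proof.
elim: n p => [|n IHn] p; first by rewrite inE => /eqP ->; rewrite /edges big_nil.
case/allpairsP => -[i q] [/= iI /IHn[wq eq sq] ->].
have c1 : count id (mkseq (pred1 i) n.+1) = 1%N.
  rewrite count_map (eq_count (a2 := pred1 i)) // count_uniq_mem ?iota_uniq //.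
  by rewrite iI.
move: (mkseq _ _) c1 (size_mkseq (pred1 i) n.+1) => B c1 sB.
by rewrite /edges big_cons -/(edges q) eq c1 /= sB sq eqxx has_count c1 wq.
Qed.

(** Keep a single earlier neighbor of each vertex and forget the other edges. *)
Lemma matches_tree (A : finType) (adj : rel A) r s : grown adj r s ->
  exists2 p, p \in tree_patterns (size s).-1 & matches adj r p s.
Proof.
elim: s => // h s IHs; have [->|sN] := eqVneq s [::].
  by move=> /= hr; exists [::]; rewrite ?inE.
rewrite grown_cons // => /and3P[_ /hasP[z zs hz] gs].
have [p pt mp] := IHs gs; have us := grown_uniq gs.
have E : mkseq (pred1 (index z s)) (size s) = [seq x == z | x <- s].
  apply: (@eq_from_nth _ false); rewrite size_mkseq ?size_map // => j js.
  rewrite nth_mkseq // (nth_map z) //= -[X in _ = (_ == X)](nth_index z zs).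
  by rewrite nth_uniq ?index_mem.
exists (mkseq (pred1 (index z s)) (size s) :: p).
  have s0 : (0 < size s)%N by rewrite lt0n size_eq0.
  rewrite [_.-1]/= -(prednK s0); apply/allpairsP; exists (index z s, p); split=> //=.
  by rewrite -/(iota 0 (size s).-1.+1) prednK // mem_iota index_mem.
rewrite /= size_mkseq eqxx mp andbT E -filter_mask.
by apply/allP => y; rewrite mem_filter => /andP[/eqP ->].
Qed.

Fixpoint all_patterns n : seq pattern :=
  if n is n'.+1 then
    [seq B :: p | B <- [seq val B | B : n.-tuple bool], p <- all_patterns n']
  else [:: [::]].

Lemma mem_all_patterns p : wf_pattern p -> p \in all_patterns (size p).
Proof.
elim: p => [|B p IHp] //= /and3P[sB _ /IHp pA].
apply/allpairsP; exists (B, p); split=> //=.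
by apply/mapP; exists (Tuple sB); rewrite ?mem_enum.
Qed.

(** Every root is required because the newly colored vertex may play any role in a copy. *)
Definition rooted_cover (H : ograph) (l : seq pattern) :=
  forall r : 'I_(fg_n H),
    exists p s, [/\ p \in l, uniq s & matches (fg_adj H) r p s].

(** One spanning connected ordering is chosen for each root. *)
Lemma root_patterns H : simple_fg H -> fg_connected H ->
  exists l, [/\ size l = fg_n H, rooted_cover H l
    & forall p, p \in l ->
        [/\ wf_pattern p, edges p = fg_edges H & size p = (fg_n H).-1]].
Proof.
move=> sH cH; have [sym irr] := sH.
have ex r : exists s, grown (fg_adj H) r s && (size s == fg_n H).
  have n0 : (0 < fg_n H)%N by apply: leq_ltn_trans (ltn_ord r).
  have [|s gs ss] := @exists_grown _ _ r (fg_n H).-1 cH sym.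
    by rewrite card_ord prednK.
  by exists s; rewrite gs ss prednK /=.
pose g r := xchoose (ex r).
have gP r : grown (fg_adj H) r (g r) /\ size (g r) = fg_n H.
  by have /andP[? /eqP] := xchooseP (ex r).
exists [seq pattern_of (fg_adj H) (g r) | r <- enum 'I_(fg_n H)].
split; first by rewrite size_map size_enum_ord.
  move=> r; have [gr sr] := gP r.
  exists (pattern_of (fg_adj H) (g r)), (g r); split.
  - by apply/mapP; exists r; rewrite ?mem_enum.
  - exact: grown_uniq gr.
  - exact: matches_pattern_of.
move=> _ /mapP[r _ ->]; have [gr sr] := gP r; split.
- exact: wf_pattern_of gr.
- exact: edges_full gr sr.
- by rewrite size_pattern_of sr.
Qed.

Lemma matches_map (A A' : eqType) (adj : rel A) (adj' : rel A') (g : A -> A') r p s :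
  (forall x y, adj x y -> adj' (g x) (g y)) ->
  matches adj r p s -> matches adj' (g r) p (map g s).
Proof.
move=> hg; elim: p s => [|B p IHp] [|h s] //=.
  by case: s => // /eqP -> /=; rewrite eqxx.
case/and3P => /eqP sB /allP hB /IHp ->; rewrite size_map sB eqxx andbT /=.
by apply/allP => y; rewrite -map_mask => /mapP[z /hB hz ->]; apply: hg.
Qed.

Lemma rooted_cover_iso H H' l : fg_iso H H' -> rooted_cover H' l -> rooted_cover H l.
Proof.
move=> [g [[g' gK g'K] adjE]] cov r.
have [p [s [pl us mp]]] := cov (g r).
exists p, (map g' s); split=> //; first by rewrite map_inj_uniq //; apply: can_inj g'K.
rewrite -[r]gK; apply: matches_map mp => x y xy.
by rewrite adjE !g'K.
Qed.

(** Patterns of one representative serve its whole isomorphism class, at most one per vertex. *)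
Lemma class_patterns (F P : ograph -> Prop) (k n : nat) :
  (forall H, F H -> simple_fg H /\ fg_connected H) ->
  (forall H, F H -> P H -> (fg_n H <= n)%N) ->
  count_iso_classes F P k ->
  exists l, [/\ (size l <= k * n)%N, forall H, F H -> P H -> rooted_cover H l
    & forall p, p \in l -> exists H,
        [/\ F H, P H, wf_pattern p, edges p = fg_edges H & size p = (fg_n H).-1]].
Proof.
move=> FS Pn [C [CP [_ Ccov]]].
have ex i : exists l, [/\ size l = fg_n (C i), rooted_cover (C i) l
    & forall p, p \in l ->
        [/\ wf_pattern p, edges p = fg_edges (C i) & size p = (fg_n (C i)).-1]].
  by have [/FS[? ?] _] := CP i; apply: root_patterns.
have [f fP] := choice ex.
exists (flatten [seq f i | i <- enum 'I_k]); split.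
- rewrite size_flatten /shape -map_comp sumnE big_map big_enum /=.
  apply: (@leq_trans (\sum_(i < k) n)%N); last by rewrite sum_nat_const card_ord.
  apply: leq_sum => i _ /=; have [-> _ _] := fP i; have [FC PC] := CP i.
  exact: Pn.
- move=> H FH PH r; have [i Hi] := Ccov H FH PH; have [_ cov _] := fP i.
  have [p [s [pl us mp]]] := rooted_cover_iso Hi cov r.
  exists p, s; split=> //; apply/flatten_mapP; exists i => //; exact: mem_enum.
move=> p /flatten_mapP[i _ /[dup] pi]; have [_ _ /(_ p pi)[? ? ?] _] := fP i.
by have [? ?] := CP i; exists (C i).
Qed.

(** Used with k = m - 2 and n = m + 1 to bound the total cost of the m! trees by 2 N. *)
Lemma fact_le_expn n k : (k.+2 <= n)%N -> ((k.+2)`! <= 2 * n ^ k)%N.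
Proof.
elim: k => // k IHk kn; rewrite factS mulnC expnSr mulnA.
by apply: leq_mul (IHk (ltnW kn)) kn.
Qed.

Lemma fg_n_gt0 H : (0 < fg_edges H)%N -> (0 < fg_n H)%N.
Proof.
by case/card_gt0P => -[x _] _; apply: leq_ltn_trans (ltn_ord x).
Qed.

Lemma fg_n_le H : simple_fg H -> fg_connected H -> (fg_n H <= (fg_edges H).+1)%N.
Proof.
move=> sH cH; have [l [sl _ lP]] := root_patterns sH cH.
case: (posnP (fg_n H)) => [->//|n0].
case: l sl lP => [E|p l _ /(_ p)]; first by rewrite -E in n0.
by rewrite mem_head => /(_ isT)[/edges_ge_size le <- sp]; rewrite -(prednK n0) -sp ltnS.
Qed.

(** * Costs of single patterns *)

Section Costs.
Local Open Scope ring_scope.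
Variables (R : realFieldType) (t b : R) (m : nat).
Hypothesis t_ge1 : 1 <= t.
Hypothesis b_ge1 : 1 <= b.

Let t_gt0 : 0 < t. Proof. exact: lt_le_trans ltr01 t_ge1. Qed.
Let b_gt0 : 0 < b. Proof. exact: lt_le_trans ltr01 b_ge1. Qed.

Definition pattern_cost p : R :=
  (t ^+ m) ^+ 2 / (t ^+ edges p * b ^+ (size p - 2)).

Lemma sum_cost_le l M : (forall p, p \in l -> pattern_cost p <= M) ->
  \sum_(p <- l) pattern_cost p <= (size l)%:R * M.
Proof.
move=> lM; rewrite mulr_natl.
apply: (@le_trans _ _ (\sum_(p <- l) M)).
  by rewrite big_seq [leRHS]big_seq; apply: ler_sum => p /lM.
by rewrite big_const_seq count_predT iter_addr_0.
Qed.

Lemma pattern_cost_le p : (m <= edges p)%N -> pattern_cost p <= t ^+ m.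
Proof.
move=> mp; rewrite /pattern_cost ler_pdivrMr ?mulr_gt0 ?exprn_gt0 // expr2.
rewrite ler_pM2l ?exprn_gt0 // -[leLHS]mulr1.
by apply: ler_pM; rewrite ?exprn_ge0 ?(ltW t_gt0) ?ler_weXn2l ?exprn_ege1.
Qed.

Lemma pattern_cost_lt p : (m < edges p)%N -> pattern_cost p <= t ^+ m / t.
Proof.
move=> mp; rewrite /pattern_cost ler_pdivrMr ?mulr_gt0 ?exprn_gt0 // expr2.
rewrite -mulrA ler_pM2l ?exprn_gt0 // mulrA -[leLHS]mulr1.
apply: ler_pM; rewrite ?exprn_ge0 ?(ltW t_gt0) ?exprn_ege1 //.
by rewrite mulrC ler_pdivlMr // -exprSr ler_weXn2l.
Qed.

Lemma tree_cost p : p \in tree_patterns m ->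
  pattern_cost p = t ^+ m / b ^+ (m - 2).
Proof.
move=> /tree_patternsP[_ Ee Es]; rewrite /pattern_cost Ee Es.
by field; rewrite ?expf_neq0 ?gt_eqF.
Qed.

End Costs.

(** * The two bounds, in terms of t *)

Section Bounds.
Local Open Scope ring_scope.

Variables (R : archiRealFieldType).
Variables (F : ograph -> Prop) (m : nat).
Hypothesis m_ge2 : (2 <= m)%N.
Hypothesis F_simple : forall H, F H -> simple_fg H /\ fg_connected H.
Hypothesis F_edges : forall H, F H -> (m <= fg_edges H)%N.

Let F_gt0 H : F H -> (0 < fg_n H)%N.
Proof. by move=> /F_edges mH; apply/fg_n_gt0/(leq_trans _ mH)/ltnW. Qed.

(** Counterpart of [chi2F_lt] over any archimedean real field. *)
Definition colorable_below (T : finType) (e : rel T) (B : R) :=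
  exists (c : nat) (col : T -> 'I_c), is_2F_coloring F e col /\ c%:R < B.

(** The number of colors is the integer part of the total cost plus one, which explains the extra 1
    in the last hypothesis. *)
Lemma colorable_of_patterns (T : finType) (e : rel T) (t b B : R) (D : nat) L :
  symmetric e -> irreflexive e -> maxdeg_le e D ->
  1 <= t -> 1 <= b -> D%:R <= t ^+ m.-1 ->
  (forall p, p \in L -> wf_pattern p && (m <= edges p)%N) ->
  (forall H, F H -> rooted_cover H L) ->
  b * t ^+ m + D%:R + (m.-1)%:R * t ^+ m + \sum_(p <- L) pattern_cost t b m p + 1 < B ->
  colorable_below e B.
Proof.
move=> es ei deg t1 b1 Dt Lw Lc; set X := (X in X + 1 < B) => XB.
have t0 : 0 < t := lt_le_trans ltr01 t1.
have b0 : 0 < b := lt_le_trans ltr01 b1.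
have X0 : 0 <= X.
  rewrite /X !addr_ge0 ?mulr_ge0 ?exprn_ge0 ?ler0n ?(ltW t0) ?(ltW b0) //.
  by apply: sumr_ge0 => p _; rewrite /pattern_cost divr_ge0 ?mulr_ge0 ?exprn_ge0 // ltW.
have /andP[le1 lt1] := truncn_itv X0.
have [col colP] := @exists_2F_coloring F T e R t b m D (Num.truncn X).+1 L
  m_ge2 es ei deg t1 b1 Dt Lw F_gt0 Lc (ltW lt1).
exists (Num.truncn X).+1, col; split=> //; apply: le_lt_trans XB.
by rewrite -natr1 lerD2r.
Qed.

(** With b = m + 1 the terms are (m+1)N, D <= N, (m-1)N, 2N for trees, kv m N for small graphs, and
    1 <= N; they add up to at most (kv m + 2m + 4)N. *)
Lemma colorable_kv (kv D : nat) (t : R) (T : finType) (e : rel T) :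
  count_iso_classes F (fun H => (fg_n H <= m)%N) kv ->
  symmetric e -> irreflexive e -> maxdeg_le e D ->
  1 <= t -> D%:R <= t ^+ m.-1 ->
  colorable_below e ((kv%:R + 71) * (m.+1)%:R * t ^+ m).
Proof.
move=> kvP es ei deg t1 Dt; have t0 : 0 < t := lt_le_trans ltr01 t1.
have [l [sl lc lP]] := class_patterns F_simple (fun H _ => id) kvP.
have b1 : 1 <= (m.+1)%:R :> R by rewrite ler1n.
have lE p : p \in l -> wf_pattern p && (m <= edges p)%N.
  by move=> /lP[H [FH _ -> -> _]]; apply: F_edges.
apply: (@colorable_of_patterns _ _ t (m.+1)%:R _ D (tree_patterns m ++ l)) => //.
- move=> p; rewrite mem_cat => /orP[/tree_patternsP[-> -> _]|/lE //]; exact: leqnn.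
- move=> H FH r; have [nm|mn] := leqP (fg_n H) m.
    have [p [s [pl us mp]]] := lc H FH nm r.
    by exists p, s; split=> //; rewrite mem_cat pl orbT.
  have [[sym irr] cH] := F_simple FH.
  have [|s gs ss] := @exists_grown _ _ r m cH sym; first by rewrite card_ord.
  have [p pt mp] := matches_tree gs; rewrite ss /= in pt.
  by exists p, s; split=> //; [rewrite mem_cat pt|apply: grown_uniq gs].
rewrite big_cat /=.
have trees_le : \sum_(p <- tree_patterns m) pattern_cost t (m.+1)%:R m p <= 2 * t ^+ m.
  apply: le_trans (sum_cost_le (M := t ^+ m / (m.+1)%:R ^+ (m - 2)) _) _.
    by move=> p /tree_cost ->.
  rewrite size_tree_patterns mulrCA mulrC ler_pM2r ?exprn_gt0 //.
  rewrite ler_pdivrMr ?exprn_gt0 ?ltr0n // -natrX -natrM ler_nat.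
  have -> : m = (m - 2).+2 by rewrite -addn2 subnK.
  by rewrite -[((m - 2).+2 - 2)%N]/(m - 2 - 0)%N subn0; apply: fact_le_expn.
have class_le : \sum_(p <- l) pattern_cost t (m.+1)%:R m p <= kv%:R * m%:R * t ^+ m.
  apply: le_trans (sum_cost_le (M := t ^+ m) _) _.
    by move=> p /lE/andP[_]; apply: pattern_cost_le.
  by rewrite -natrM ler_pM2r ?exprn_gt0 // ler_nat.
have N1 : 1 <= t ^+ m by rewrite exprn_ege1.
have DN : D%:R <= t ^+ m by apply: le_trans Dt _; rewrite ler_weXn2l ?leq_pred.
have m1E : (m.-1)%:R = m%:R - 1 :> R by rewrite -subn1 natrB // ltnW.
have kN : 0 <= kv%:R * t ^+ m by rewrite mulr_ge0 ?exprn_ge0 // ltW.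
have mN : 2 * t ^+ m <= m%:R * t ^+ m by rewrite ler_pM2r ?exprn_gt0 // ler_nat.
rewrite -natr1 in trees_le class_le; rewrite m1E -[m.+1%:R]natr1.
move: (t ^+ m) (\sum_(p <- l) _) (\sum_(p <- _) _) trees_le
  class_le N1 DN kN mN => N S1 S2 *; lra.
Qed.

Lemma colorable_ke (ke : nat) :
  count_iso_classes F (fun H => fg_edges H = m) ke ->
  exists K : nat, forall (D : nat) (t : R) (T : finType) (e : rel T),
  symmetric e -> irreflexive e -> maxdeg_le e D ->
  1 <= t -> D%:R <= t ^+ m.-1 ->
  forall B, (m%:R + ke%:R * (m.+1)%:R + K%:R / t) * t ^+ m < B ->
  colorable_below e B.
Proof.
move=> keP.
have [H FH <-|l [sl lc lP]] :=
    @class_patterns F (fun H => fg_edges H = m) ke m.+1 F_simple _ keP.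
  by have [sH cH] := F_simple FH; apply: fg_n_le.
pose dense := [seq p <- flatten [seq all_patterns n | n <- iota 0 m.+2]
              | wf_pattern p && (m < edges p)%N].
(* Each dense pattern costs at most N / t, and so do the terms [D] and 1, whence the 2. *)
exists (size dense + 2)%N => D t T e es ei deg t1 Dt B ltB.
have t0 : 0 < t := lt_le_trans ltr01 t1.
have lE p : p \in l -> wf_pattern p && (m <= edges p)%N.
  by move=> /lP[H [_ mE wp eE _]]; rewrite wp eE mE leqnn.
have dE p : p \in dense -> wf_pattern p && (m < edges p)%N.
  by rewrite mem_filter => /andP[].
apply: (@colorable_of_patterns _ _ t 1 _ D (dense ++ l)) => //.
- move=> p; rewrite mem_cat => /orP[/dE/andP[-> /ltnW //]|/lE //].
- move=> H FH r; have [eH|eH] := eqVneq (fg_edges H) m.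
    have [p [s [pl us mp]]] := lc H FH eH r.
    by exists p, s; split=> //; rewrite mem_cat pl orbT.
  have [[sym irr] cH] := F_simple FH.
  have {}eH : (m < fg_edges H)%N by rewrite ltn_neqAle eq_sym eH F_edges.
  suff [s [gs es' ss]] : exists s, [/\ grown (fg_adj H) r s,
      (m < edges (pattern_of (fg_adj H) s))%N & (size s <= m.+2)%N].
    exists (pattern_of (fg_adj H) s), s; split; last exact: matches_pattern_of.
      have wp := wf_pattern_of gs.
      rewrite mem_cat mem_filter wp es' !andTb; apply/orP; left.
      apply/flatten_mapP; exists (size (pattern_of (fg_adj H) s)).
        rewrite mem_iota add0n size_pattern_of.
        by case: (size s) ss.
      exact: mem_all_patterns.
    exact: grown_uniq gs.
  have n0 := F_gt0 FH.
  have [nm|mn] := leqP (fg_n H) m.+2.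
    have [|s gs ss] := @exists_grown _ _ r (fg_n H).-1 cH sym.
      by rewrite card_ord prednK.
    rewrite prednK // in ss; exists s; split; rewrite ?ss //.
    by rewrite (edges_full _ gs ss).
  (* Any m + 2 vertices grown from the root already span at least m + 1 edges. *)
  have [|s gs ss] := @exists_grown _ _ r m.+1 cH sym.
    by rewrite card_ord ltnW.
  exists s; rewrite ss; split=> //.
  have := edges_ge_size (wf_pattern_of gs).
  by rewrite size_pattern_of ss.
apply: le_lt_trans ltB; rewrite big_cat /=.
have dense_le :
    \sum_(p <- dense) pattern_cost t 1 m p <= (size dense)%:R * (t ^+ m / t).
  by apply: sum_cost_le => p /dE/andP[_]; apply: pattern_cost_lt.
have class_le : \sum_(p <- l) pattern_cost t 1 m p <= ke%:R * (m.+1)%:R * t ^+ m.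
  apply: le_trans (sum_cost_le (M := t ^+ m) _) _.
    by move=> p /lE/andP[_]; apply: pattern_cost_le.
  by rewrite -natrM ler_pM2r ?exprn_gt0 // ler_nat.
have NtE : t ^+ m / t = t ^+ m.-1.
  by case: (m) m_ge2 => // k _; rewrite exprSr mulfK // gt_eqF.
have N1 : 1 <= t ^+ m / t by rewrite NtE exprn_ege1.
have DN : D%:R <= t ^+ m / t by rewrite NtE.
have m1E : (m.-1)%:R = m%:R - 1 :> R by rewrite -subn1 natrB // ltnW.
have -> : (m%:R + ke%:R * (m.+1)%:R + (size dense + 2)%:R / t) * t ^+ m =
    m%:R * t ^+ m + ke%:R * (m.+1)%:R * t ^+ m + (size dense + 2)%:R * (t ^+ m / t).
  by field; rewrite gt_eqF.
rewrite m1E natrD; move: (t ^+ m / t) (\sum_(p <- l) _) (\sum_(p <- _) _) dense_le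
  class_le N1 DN => N' S1 S2 *; lra.
Qed.

End Bounds.

(** * Real powers and the error term *)

Section RealRoot.
Local Open Scope ring_scope.

Lemma Rpower_root (m D : nat) : (2 <= m)%N -> (1 <= D)%N ->
  exists t : R, [/\ 1 <= t, t ^+ m.-1 = D%:R
    & t ^+ m = Rpower (INR D) (Rdiv (INR m) (INR (m - 1)))].
Proof.
move=> m2 D1; have D0 : Rlt 0 (INR D) by apply/lt_0_INR/ssrnat.ltP.
have m1 : INR (m - 1) <> 0%R by apply: not_0_INR; case: (m) m2 => [|[|]].
pose t := Rpower (INR D) (Rinv (INR (m - 1))).
have t0 : Rlt 0 t by apply: exp_pos.
have tX k : t ^+ k = Rpower (INR D) (Rmult (Rinv (INR (m - 1))) (INR k)).
  by rewrite -RpowE -Rpower_pow // Rpower_mult.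
have tm : t ^+ m.-1 = D%:R.
  by rewrite tX subn1 -subn1 Rinv_l // Rpower_1 // INRE.
exists t; split=> //; last by rewrite tX Rmult_comm.
rewrite leNgt; apply/negP => t1.
have t0' : 0 <= t by apply/ltW/RltP.
have : t ^+ m.-1 < 1 by rewrite exprn_ilt1 //; case: (m) m2 => [|[|]].
by rewrite tm (ltr_nat _ D 1) ltnNge D1.
Qed.

(** The main term has coefficient m where m + 1 is allowed, so one unit is left to absorb the error
    [x]. *)
Lemma slack (R : realFieldType) (m k K x : R) :
  x < 1 + K * (m + 1) -> m + k * (m + 1) + x < (k + 1 + K) * (m + 1).
Proof. by move=> *; lra. Qed.

End RealRoot.

Lemma chi2F_lt_of_colorable (F : ograph -> Prop) (T : finType) (e : rel T) (B : R) :
  colorable_below F e B -> chi2F_lt F e B.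
Proof.
move=> [c [col [colP cB]]]; exists c, col; split=> //.
by apply/RltP; rewrite INRE.
Qed.

Theorem theorem12 (m : nat) (F : ograph -> Prop) (kv ke : nat) :
  (2 <= m)%N ->
  (forall H, F H ->
     simple_fg H /\ fg_connected H /\ fg_bipartite H /\ (m <= fg_edges H)%N) ->
  count_iso_classes F (fun H => (fg_n H <= m)%N) kv ->
  count_iso_classes F (fun H => fg_edges H = m) ke ->
  (forall D : nat, (1 <= D)%N ->
     chi2F_Delta_lt F D
       (Rmult (Rmult (Rplus (INR kv) (INR 71)) (INR (m + 1)))
          (Rpower (INR D) (Rdiv (INR m) (INR (m - 1))))))
  /\
  (exists eps : nat -> R, Un_cv eps (INR 0) /\
     forall D : nat, (1 <= D)%N ->
       chi2F_Delta_lt F D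
         (Rmult (Rmult (Rplus (Rplus (INR ke) (INR 1)) (eps D)) (INR (m + 1)))
            (Rpower (INR D) (Rdiv (INR m) (INR (m - 1)))))).
Proof.
move=> m2 FP kvP keP.
have F_simple H : F H -> simple_fg H /\ fg_connected H by case/FP => ? [].
have F_edges H : F H -> (m <= fg_edges H)%N by case/FP => _ [_ []].
split=> [D D1 T e es ei deg|].
  have [t [t1 tD tm]] := Rpower_root m2 D1; apply: chi2F_lt_of_colorable.
  have := colorable_kv m2 F_simple F_edges kvP es ei deg t1.
  by rewrite tD lexx tm addn1 !INRE; apply.
have [K KP] := colorable_ke R m2 F_simple F_edges keP.
(* The second bound holds with no error term as soon as t > K. *)
exists (fun D => if (D <= K ^ m.-1)%N then INR K else INR 0); split.
  move=> d d0; exists (K ^ m.-1).+1 => n /ssrnat.leP nK.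
  by rewrite leqNgt nK /= R_dist_eq.
move=> D D1 T e es ei deg; have [t [t1 tD tm]] := Rpower_root m2 D1.
apply: chi2F_lt_of_colorable; have DK := KP D t T e es ei deg t1.
apply: DK; first by rewrite tD.
rewrite -tm addn1 !INRE -!RplusE -!RmultE.
have t0 : (0 < t)%R := lt_le_trans ltr01 t1.
rewrite ltr_pM2r ?exprn_gt0 // -[(m.+1)%:R%R]natr1.
(* For small [D], t >= 1 gives K / t <= K, which the error term covers; otherwise t^(m-1) = D >
   K^(m-1), so K / t < 1. *)
apply: slack; have [DK|KD] := leqP D => /=.
  rewrite mulrDr mulr1 addrA (@le_lt_trans _ _ K%:R%R) //.
    by rewrite ler_pdivrMr // ler_peMr // ler0n.
  by rewrite ltrDr ltr_wpDr ?ltr01 // mulr_ge0 ?ler0n.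
rewrite mul0r addr0 ltr_pdivrMr // mul1r.
rewrite -(ltr_pXn2r (n := m.-1)) ?nnegrE ?ler0n ?(ltW t0) //.
  by rewrite tD -natrX ltr_nat.
by case: (m) m2 => [|[|]].
Qed.
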